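(* Let $K\subset\mathbb R^d$ be compact. For $n\in\mathbb N$ let $p_{n,0},\dots,p_{n,l_n}\in K$ and let $c_{n,i}:K\to[0,\infty)$, $i=0,\dots,l_n$, satisfy $\sum_{i=0}^{l_n}c_{n,i}(p)=1$ for all $p\in K$. Assume that for every $p\in K$, $\delta_n(p)=\min_{0\le i\le l_n}\|p-p_{n,i}\|\to0$ as $n\to\infty$. For $f:K\to\mathbb R$ and $F:K\to\mathfrak J$ define $$\widetilde O_n(f,p)=\sum_{i=0}^{l_n}c_{n,i}(p)f(p_{n,i}),\qquad O_n(F,p)=\bigotimes_{i=0}^{l_n}c_{n,i}(p)F(p_{n,i}).$$ Assume that for any continuous $f:K\to\mathbb R$ and any $\epsilon>0$ there exists $\widetilde N_{f,\epsilon}$ such that $|f(p)-\widetilde O_n(f,p)|<\epsilon$ for all $n\ge\widetilde N_{f,\epsilon}$ and all $p\in K$. Then for any $F:K\to\mathfrak J$ continuous with respect to $d_\mu$ and any $\epsilon>0$ there exists $N_{F,\epsilon}$ such that $d_\mu(F(p),O_n(F,p))<\epsilon$ for all $n\ge N_{F,\epsilon}$ and all $p\in K$.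
   Context: Fix $m\ge1$ and let $\mu$ be Lebesgue measure on $\mathbb R^m$. $\mathbb J$ denotes the collection of Jordan measurable subsets of $\mathbb R^m$ (bounded sets whose boundary has Lebesgue measure zero). $\operatorname{ci}(A)$ is the closure of the interior of $A$; a bounded set $A$ is regular compact if $A=\operatorname{ci}(A)$. $\mathfrak J\subset\mathbb J$ is the collection of regular compact sets in $\mathbb J$ (including $\emptyset$), with the metric $d_\mu(A,B)=\mu(A\Delta B)$, $\Delta$ being symmetric difference. A subset-generating function is a map $\Psi:\mathbb J\times[0,1]\to\mathfrak J$ such that for all $A\in\mathbb J$ and $s,t\in[0,1]$: (1) $\Psi(A,t)\subseteq A$ up to a null set, i.e. $\mu(\Psi(A,t)\setminus A)=0$; (2) $\mu(\Psi(A,t))=t\,\mu(A)$; (3) $\Psi(A,s)\subseteq\Psi(A,t)$ if $s\le t$. A subset-generating function $\Psi$ is fixed. For $A_0,\dots,A_n\in\mathfrak J$ and nonempty $\chi\subseteq\{0,\dots,n\}$ put $\Omega_\chi=\big(\bigcap_{k\in\chi}A_k\big)\setminus\big(\bigcup_{l\in\{0,\dots,n\}\setminus\chi}A_l\big)$, and $\Omega_\emptyset=\emptyset$. For weights $\alpha_i\in[0,1]$ with $\sum_i\alpha_i=1$, the partition average is $\bigotimes_{i=0}^n\alpha_iA_i:=\bigcup_{\chi\subseteq\{0,\dots,n\}}\Psi\big(\Omega_\chi,\sum_{k\in\chi}\alpha_k\big)\in\mathfrak J$. $\|\cdot\|$ is the Euclidean norm. *)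

(* Defs.v *)
From HB Require Import structures.
From mathcomp Require Import all_boot all_order all_algebra.
From mathcomp Require Import all_classical all_reals all_analysis.

Set Implicit Arguments.
Unset Strict Implicit.
Unset Printing Implicit Defensive.

Import Order.TTheory GRing.Theory Num.Theory.
Import numFieldNormedType.Exports.

Local Open Scope classical_set_scope.
Local Open Scope ring_scope.

(* R^k is 'rV[R]_k.  The library topology and norm on it come from the sup
   norm; they have the same open, bounded and compact sets as the Euclidean
   norm, which is only needed for distances. *)
Definition euclidean_norm (R : realType) (k : nat) (x : 'rV[R]_k) : R :=
  Num.sqrt (\sum_(i < k) x ord0 i ^+ 2).

Definition box (R : realType) (m : nat) (a b : 'rV[R]_m) : set 'rV[R]_m :=
  [set x | forall i, x ord0 i \in `]a ord0 i, b ord0 i]].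

(* Covers of X by countably many boxes; a = b gives the empty box when
   0 < m, so finite covers are included. *)
Definition box_cover (R : realType) (m : nat) (X : set 'rV[R]_m) :
    set (nat -> 'rV[R]_m * 'rV[R]_m) :=
  [set B : nat -> 'rV[R]_m * 'rV[R]_m |
    (forall k i, (B k).1 ord0 i <= (B k).2 ord0 i) /\
    X `<=` \bigcup_k box (B k).1 (B k).2].

(* Lebesgue measure on R^m, given for all sets by its outer measure: the two
   agree on Lebesgue measurable sets, hence on Jordan measurable sets. *)
Definition lebesgue_Rm (R : realType) (m : nat) (X : set 'rV[R]_m) : \bar R :=
  ereal_inf [set (\sum_(k <oo)
      (\prod_(i < m) ((B k).2 ord0 i - (B k).1 ord0 i))%:E)%E
    | B in box_cover X].

Definition jordan_measurable (R : realType) (m : nat) (A : set 'rV[R]_m) :=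
  bounded_set A /\ lebesgue_Rm (closure A `\` A°) = 0%E.

Definition ci (R : realType) (m : nat) (A : set 'rV[R]_m) : set 'rV[R]_m :=
  closure A°.

Definition regular_compact (R : realType) (m : nat) (A : set 'rV[R]_m) :=
  bounded_set A /\ A = ci A.

Definition regular_jordan (R : realType) (m : nat) (A : set 'rV[R]_m) :=
  jordan_measurable A /\ regular_compact A.

Definition dmu (R : realType) (m : nat) (A B : set 'rV[R]_m) : \bar R :=
  lebesgue_Rm ((A `\` B) `|` (B `\` A)).

(* Psi is a total function; only its values on Jordan measurable sets and
   parameters in [0, 1] are constrained or used. *)
Record subset_generating (R : realType) (m : nat)
    (Psi : set 'rV[R]_m -> R -> set 'rV[R]_m) : Prop := SubsetGenerating {
  subset_generating_regular : forall A t, jordan_measurable A ->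
    0 <= t <= 1 -> regular_jordan (Psi A t) ;
  subset_generating_sub : forall A t, jordan_measurable A ->
    0 <= t <= 1 -> lebesgue_Rm (Psi A t `\` A) = 0%E ;
  subset_generating_measure : forall A t, jordan_measurable A ->
    0 <= t <= 1 -> lebesgue_Rm (Psi A t) = (t%:E * lebesgue_Rm A)%E ;
  subset_generating_mono : forall A s t, jordan_measurable A ->
    0 <= s <= 1 -> 0 <= t <= 1 -> s <= t -> Psi A s `<=` Psi A t }.

Definition Omega (R : realType) (m n : nat) (A : 'I_n.+1 -> set 'rV[R]_m)
    (chi : {set 'I_n.+1}) : set 'rV[R]_m :=
  if chi == finset.set0 then set0 else
  (\bigcap_(k in [set k | k \in chi]) A k) `\`
  (\bigcup_(l in [set l | l \notin chi]) A l).

Definition partition_average (R : realType) (m : nat)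
    (Psi : set 'rV[R]_m -> R -> set 'rV[R]_m) (n : nat)
    (alpha : 'I_n.+1 -> R) (A : 'I_n.+1 -> set 'rV[R]_m) : set 'rV[R]_m :=
  \bigcup_(chi : {set 'I_n.+1}) Psi (Omega A chi) (\sum_(k in chi) alpha k).

(* A map K -> J is a function on all of R^d whose restriction to K is J-valued
   and continuous for dmu. *)
Definition dmu_continuous (R : realType) (d m : nat) (K : set 'rV[R]_d)
    (F : 'rV[R]_d -> set 'rV[R]_m) : Prop :=
  forall p, K p -> forall eps : R, 0 < eps ->
    \forall q \near within K (nbhs p), (dmu (F p) (F q) < eps%:E)%E.

Section operators.
Context (R : realType) (d m : nat) (l : nat -> nat).
Variable pt : forall n : nat, 'I_(l n).+1 -> 'rV[R]_d.
Variable c : forall n : nat, 'I_(l n).+1 -> 'rV[R]_d -> R.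

Definition delta (n : nat) (p : 'rV[R]_d) : R :=
  \big[Num.min / euclidean_norm (p - pt (ord0 : 'I_(l n).+1))]_(i < (l n).+1)
    euclidean_norm (p - pt i).

Definition real_operator (n : nat) (f : 'rV[R]_d -> R) (p : 'rV[R]_d) : R :=
  \sum_(i < (l n).+1) c i p * f (pt i).

Definition set_operator (Psi : set 'rV[R]_m -> R -> set 'rV[R]_m) (n : nat)
    (F : 'rV[R]_d -> set 'rV[R]_m) (p : 'rV[R]_d) : set 'rV[R]_m :=
  partition_average Psi (fun i : 'I_(l n).+1 => c i p) (fun i => F (pt i)).

End operators.

(* Main.v *)
(* The partition average satisfies
     d(B, (x)_i alpha_i A_i) <= 3 sum_i alpha_i d(B, A_i),
   by comparing both sides on each cell of the Venn diagram of the A_i.  Hence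
   if p0 is fixed and f(q) = d(F(p0), F(q)), a real continuous function,
     d(F(p), O_n(F, p)) <= 3 sum_i c_{n,i}(p) (f(p) + f(p_{n,i}))
                         = 3 (f(p) + O~_n(f, p)),
   which is uniformly small for p near p0 and n large because f(p0) = 0 and
   O~_n(f, .) converges uniformly to f; compactness of K makes n independent
   of p0. *)
Require Import Defs.
From HB Require Import structures.
From mathcomp Require Import all_boot all_order all_algebra.
From mathcomp Require Import lra.
From mathcomp Require Import all_classical all_reals all_analysis.

Set Implicit Arguments.
Unset Strict Implicit.
Unset Printing Implicit Defensive.

Import Order.TTheory GRing.Theory Num.Theory.
Import numFieldNormedType.Exports.

Local Open Scope classical_set_scope.
Local Open Scope ring_scope.

(** Volume is additive when a box is cut by the hyperplane [x_j = t]: only factor [j] changes, and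
    [(t - a j) + (b j - t) = b j - a j]. *)
Lemma prod_cut (R : comPzRingType) (I : finType) (a b : I -> R) (j : I) (t : R) :
  \prod_i ((if i == j then t else b i) - a i) +
  \prod_i (b i - (if i == j then t else a i)) = \prod_i (b i - a i).
Proof.
rewrite (bigD1 j)//= [X in _ + X](bigD1 j)//= [RHS](bigD1 j)//= eqxx.
rewrite (eq_bigr (fun i => b i - a i)) => [|i /negbTE->//].
rewrite [X in _ + _ * X](eq_bigr (fun i => b i - a i)) => [|i /negbTE->//].
by rewrite -mulrDl addrC subrKA.
Qed.

(** * Lebesgue outer measure from countable box covers *)

Section outer_measure.
Context (R : realType) (m : nat).
Local Notation mu := (@lebesgue_Rm R m.+1).
Implicit Types (X : set 'rV[R]_m.+1) (B : nat -> 'rV[R]_m.+1 * 'rV[R]_m.+1).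

Let vol (c : 'rV[R]_m.+1 * 'rV[R]_m.+1) : \bar R :=
  (\prod_(i < m.+1) (c.2 ord0 i - c.1 ord0 i))%:E.

Lemma box_cover_vol_ge0 X B k : box_cover X B -> (0 <= vol (B k))%E.
Proof.
by case=> le_B _; rewrite lee_fin prodr_ge0// => i _; rewrite subr_ge0.
Qed.

Lemma lebesgue_Rm_ge0 X : (0 <= mu X)%E.
Proof.
apply: le_ereal_inf_tmp => _ [B covB <-]; apply: nneseries_ge0 => k _ _.
exact: box_cover_vol_ge0 covB.
Qed.

Lemma lebesgue_Rm_le X B : box_cover X B -> (mu X <= \sum_(k <oo) vol (B k))%E.
Proof. by move=> covB; apply: ereal_inf_lbound; exists B. Qed.

Lemma lebesgue_Rm_box X (a b : 'rV[R]_m.+1) :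
  (forall i, a ord0 i <= b ord0 i) -> X `<=` box a b -> (mu X <= vol (a, b))%E.
Proof.
move=> ab Xab; pose B k := if k is 0%N then (a, b) else (a, a).
have /lebesgue_Rm_le/le_trans : box_cover X B.
  by split=> [[|k] i //=|x /Xab ?]; exists 0%N.
apply; rewrite nneseries_recl//; last first.
  by move=> [|k] _; rewrite lee_fin prodr_ge0// => i _; rewrite subr_ge0//=.
rewrite eseries_cond/= eseries0 ?adde0// => -[|k] //= _ _.
by rewrite /vol big_ord_recl/= subrr mul0r.
Qed.

Lemma lebesgue_Rm0 : mu set0 = 0%E.
Proof.
apply/eqP; rewrite eq_le lebesgue_Rm_ge0 andbT.
have /le_trans := @lebesgue_Rm_box set0 0 0 (fun=> lexx _) (@sub0set _ _).
by apply; rewrite /vol/= big_ord_recl subrr mul0r.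
Qed.

Lemma le_lebesgue_Rm : {homo mu : X Y / X `<=` Y >-> (X <= Y)%E}.
Proof.
move=> X Y XY; apply: le_ereal_inf => _ [B [le_B YB] <-].
by exists B => //; split => // x /XY/YB.
Qed.

(** If all [A n] have finite measure, covers optimal up to [e / 2 ^ n.+1] are merged into one
    sequence of boxes with total excess at most [e]. *)
Lemma lebesgue_Rm_sigma_subadditive : sigma_subadditive mu.
Proof.
move=> A; have [[i Ai]|/forallNP Afin] := pselect (exists i, mu (A i) = +oo%E).
  rewrite (eseries_pinfty _ _ Ai) ?leey// => n _.
  by rewrite gt_eqF// (lt_le_trans _ (lebesgue_Rm_ge0 _)).
apply/lee_addgt0Pr => e e0.
apply: le_trans (epsilon_trick xpredT _ (ltW e0)); last first.
  by move=> n; exact: lebesgue_Rm_ge0.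
have /choice[B covB] : forall n, exists B, box_cover (A n) B /\
    (\sum_(k <oo) vol (B k) <= mu (A n) + (e / (2 ^ n.+1)%:R)%:E)%E.
  move=> n; have en : 0 < e / (2 ^ n.+1)%:R by rewrite divr_gt0// ltr0n expn_gt0.
  have fin : mu (A n) \is a fin_num.
    by rewrite ge0_fin_numE ?lebesgue_Rm_ge0// ltey; exact/eqP/Afin.
  by have [_ [B covB <-] /ltW] := lb_ereal_inf_adherent en fin; exists B.
have B_ge0 i j : (0 <= vol (B i j))%E by exact: box_cover_vol_ge0 (covB i).1.
(* The bijection [f] from [nat] to [nat * nat] lists all boxes of all covers; nonnegativity allows
   the double sum to be rearranged. *)
have /card_esym/card_set_bijP[f bijf] := card_nat2.
apply: (@le_trans _ _ (\sum_(k <oo) vol (B (f k).1 (f k).2))%E).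
  apply: (@lebesgue_Rm_le _ (fun k => B (f k).1 (f k).2)).
  split=> [k i|x [n _ /(covB n).1.2[k _ Bx]]]; first exact: (covB _).1.1.
  have [p _ fp] := (set_bij_surj bijf : set_surj _ _ _) (n, k) I.
  by exists p => //; rewrite fp.
rewrite nneseries_esumT//.
rewrite -(reindex_esum _ _ _ (fun p => vol (B p.1 p.2)) bijf).
have -> : [set: nat * nat] = [set: nat] `*`` (fun=> [set: nat]).
  by apply/seteqP; split.
rewrite -(@esum_esum _ _ _ _ _ (fun i j => vol (B i j)))//.
rewrite -nneseries_esumT; last by move=> n; exact: esum_ge0.
apply: lee_nneseries => [n _ _|n _]; first exact: esum_ge0.
by rewrite -nneseries_esumT//; exact: (covB n).2.
Qed.

End outer_measure.

(** Positive dimension matters: in dimension 0 each box has the empty product 1 as volume, so even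
    the empty set would get infinite measure. *)
HB.instance Definition _ (R : realType) (m : nat) :=
  isOuterMeasure.Build R 'rV[R]_m.+1 (@lebesgue_Rm R m.+1)
    (@lebesgue_Rm0 R m) (@lebesgue_Rm_ge0 R m) (@le_lebesgue_Rm R m)
    (@lebesgue_Rm_sigma_subadditive R m).

(** * Carathéodory measurability of boxes, open sets and Jordan sets *)

Section measurability.
Context (R : realType) (m : nat).
Local Notation mu := (@lebesgue_Rm R m.+1).
Local Notation cara := (caratheodory_type (@lebesgue_Rm R m.+1)).

(** The hyperplane cuts any box cover of [X] into covers of the two parts of [X], with the same
    total volume by [prod_cut]. *)
Lemma caratheodory_halfspace (j : 'I_m.+1) (t : R) :
  mu.-caratheodory [set x | x ord0 j <= t].
Proof.
apply: le_caratheodory_measurable => X.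
apply: le_ereal_inf_tmp => _ [B [le_B XB] <-].
(* Clamping [t] to the [j]-th side of the box keeps the corners of both halves ordered even when the
   hyperplane misses the box. *)
pose cut k := Num.max ((B k).1 ord0 j) (Num.min ((B k).2 ord0 j) t).
pose upd (v : 'rV[R]_m.+1) s : 'rV[R]_m.+1 :=
  \row_i (if i == j then s else v ord0 i).
pose Bl k := ((B k).1, upd (B k).2 (cut k)).
pose Bu k := (upd (B k).1 (cut k), (B k).2).
have cut_ge k : (B k).1 ord0 j <= cut k by rewrite le_max lexx.
have cut_le k : cut k <= (B k).2 ord0 j.
  by rewrite ge_max le_B/= ge_min lexx.
have covl : box_cover (X `&` [set x | x ord0 j <= t]) Bl.
  split=> [k i|x [/XB[k _ Bx] /= xt]].
    by rewrite /= mxE; case: eqVneq => [->|_]; rewrite ?cut_ge ?cut_le ?le_B.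
  exists k => // i; have := Bx i; rewrite /= !in_itv/= mxE.
  case: eqVneq => [->|//] /andP[->/= xb].
  by rewrite le_max le_min xb xt orbT.
have covu : box_cover (X `&` ~` [set x | x ord0 j <= t]) Bu.
  split=> [k i|x [/XB[k _ Bx] /= /negP]].
    by rewrite /= mxE; case: eqVneq => [->|_]; rewrite ?cut_ge ?cut_le ?le_B.
  rewrite -ltNge => tx.
  exists k => // i; have := Bx i; rewrite /= !in_itv/= mxE.
  case: eqVneq => [->|//] /andP[ax ->].
  by rewrite andbT gt_max ax gt_min tx orbT.
apply: (le_trans (leeD (lebesgue_Rm_le covl) (lebesgue_Rm_le covu))).
rewrite -nneseriesD => [|k _ _|k _ _]; last 2 first.
- exact: box_cover_vol_ge0 covl.
- exact: box_cover_vol_ge0 covu.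
rewrite le_eqVlt; apply/orP; left; apply/eqP/eq_eseriesr => k _.
rewrite -[in RHS](prod_cut (fun i => (B k).1 ord0 i) _ j (cut k)) EFinD.
by congr (_%:E + _%:E)%E; apply: eq_bigr => i _; rewrite /= mxE.
Qed.

Lemma caratheodory_box (a b : 'rV[R]_m.+1) : mu.-caratheodory (box a b).
Proof.
have -> : box a b = \bigcap_(i : 'I_m.+1)
    ([set x | x ord0 i <= b ord0 i] `\` [set x | x ord0 i <= a ord0 i]).
  apply/seteqP; split=> [x abx i _|x abx i].
    have := abx i; rewrite in_itv/= => /andP[ax xb].
    by split=> //=; apply/negP; rewrite -ltNge.
  by have [/= xb /negP] := abx i I; rewrite -ltNge in_itv/= xb => ->.
apply: (@fin_bigcap_measurable _ cara) => // i _.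
by apply: measurableD; exact: caratheodory_halfspace.
Qed.

(** An open set is the union of the countably many boxes with rational corners that it contains. *)
Lemma caratheodory_open (U : set 'rV[R]_m.+1) : open U -> mu.-caratheodory U.
Proof.
move=> oU; pose ratmx (v : 'rV[rat]_m.+1) : 'rV[R]_m.+1 := map_mx ratr v.
pose D := [set c : 'rV[rat]_m.+1 * 'rV[rat]_m.+1 |
            box (ratmx c.1) (ratmx c.2) `<=` U].
have -> : U = \bigcup_(c in D) box (ratmx c.1) (ratmx c.2).
  apply/seteqP; split=> [x Ux|x [c Dc]]; last exact: Dc.
  have /nbhs_ballP[e /= e0 xeU] : nbhs x U by exact: open_nbhs_nbhs.
  (* Corners chosen within [e] of [x] on either side give a box around [x] inside the sup-norm ball
     of radius [e]. *)
  have /choice[q qx] : forall i, exists q : rat,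
      ratr q \in `]x ord0 i - e, x ord0 i[.
    by move=> i; apply: rat_in_itvoo; rewrite ltrBlDr ltrDl.
  have /choice[r rx] : forall i, exists r : rat,
      ratr r \in `]x ord0 i, x ord0 i + e[.
    by move=> i; apply: rat_in_itvoo; rewrite ltrDl.
  exists (\row_i q i, \row_i r i) => [y /= yB|i]; last first.
    rewrite !mxE in_itv/=; have := qx i; have := rx i.
    by rewrite !in_itv/= => /andP[/ltW -> _] /andP[_ ->].
  apply: xeU; split=> // i j; rewrite ord1 {i}; have := yB j; rewrite !mxE.
  have := qx j; have := rx j; rewrite !in_itv/= /ball/= => ? ? ?.
  by rewrite ltr_norml; lra.
rewrite bigcup_mkcond.
apply: (@countable_bigcupT_measurable _ cara) => [|c].
  exact: countableP.
case: ifP => _; first exact: caratheodory_box.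
exact: measurable0.
Qed.

Lemma caratheodory_null (A : set 'rV[R]_m.+1) :
  mu A = 0%E -> mu.-caratheodory A.
Proof.
move=> A0; apply: le_caratheodory_measurable => X.
rewrite [X in (X + _)%E](_ : _ = 0%E) ?add0e.
  by apply: le_outer_measure; exact: subIsetl.
apply/eqP; rewrite eq_le outer_measure_ge0 andbT -A0.
by apply: le_outer_measure; exact: subIsetr.
Qed.

(** [A] is its open interior together with a subset of its null boundary. *)
Lemma jordan_caratheodory (A : set 'rV[R]_m.+1) :
  jordan_measurable A -> mu.-caratheodory A.
Proof.
move=> [_ bdA]; rewrite -(setDUK (@interior_subset _ A)).
apply: caratheodory_measurable_setU.
  by apply: caratheodory_open; exact: open_interior.
apply: caratheodory_null; apply/eqP; rewrite eq_le outer_measure_ge0 andbT -bdA.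
by apply: le_outer_measure; apply: setSD; exact: subset_closure.
Qed.

Lemma bounded_lebesgue_Rm (A : set 'rV[R]_m.+1) :
  bounded_set A -> (mu A < +oo)%E.
Proof.
move=> /pinfty_ex_gt0[M M0 AM].
(* The lower corner is [- M - 1] because boxes are open on the left and coordinates may equal
   [- M]. *)
have := @lebesgue_Rm_box R m A (\row__ (- M - 1)) (\row__ M).
move=> /(_ _ _)/le_lt_trans; apply; last exact: ltey.
- by move=> i; rewrite !mxE; lra.
- move=> x /AM/= xM i; rewrite !mxE in_itv/=.
  have : `|x ord0 i| <= M.
    apply: le_trans xM.
    rewrite [leRHS]/Num.norm/= mx_normrE.
    by apply: (le_bigmax _ (fun p => `|x p.1 p.2|) (ord0, i)).
  by rewrite ler_norml => /andP[]; lra.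
Qed.

End measurability.

(** * The averaging inequality for an abstract outer measure, cell by cell *)

Section average.
Context (R : realType) (T : Type) (mu : {outer_measure set T -> \bar R}).
Local Open Scope ereal_scope.

Definition symdiff (A B : set T) : set T := (A `\` B) `|` (B `\` A).

Lemma outer_measure_null_fin (I : finType) (N : I -> set T) :
  (forall i, mu (N i) = 0) -> mu (\bigcup_i N i) = 0.
Proof.
move=> N0; have null (s : seq I) : mu [set x | exists2 i, i \in s & N i x] = 0.
  elim: s => [|i s IH].
    by rewrite [X in mu X](_ : _ = set0)// predeqE => x; split=> // -[].
  apply/eqP; rewrite eq_le outer_measure_ge0 andbT.
  rewrite -[leRHS]adde0 -[X in X + _](N0 i) -[X in _ + X]IH.
  apply: le_trans (outer_measureU2 _ _ _); apply: le_outer_measure => x [j].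
  by rewrite inE => /orP[/eqP->|]; [left|right; exists j].
apply/eqP; rewrite eq_le outer_measure_ge0 andbT -(null (enum I)).
by apply: le_outer_measure => x [i _ Nx]; exists i => //; rewrite mem_enum.
Qed.

(** The pieces [W i] are split off one at a time by the Carathéodory condition, so [X] may be
    arbitrary. *)
Lemma caratheodory_sum_fin (I : finType) (W : I -> set T) (X : set T) :
  (forall i, mu.-caratheodory (W i)) ->
  (forall x, exists i, W i x) -> (forall i j x, W i x -> W j x -> i = j) ->
  mu X = \sum_i mu (X `&` W i).
Proof.
move=> mW coverW disjW; have sumW (s : seq I) : uniq s ->
    mu (X `&` [set x | exists2 i, i \in s & W i x]) =
    \sum_(i <- s) mu (X `&` W i).
  elim: s => [_|i s IH /= /andP[nis us]].
    rewrite big_nil [X in mu X](_ : _ = set0)//.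
    by rewrite predeqE => x; split=> // -[_ []].
  rewrite big_cons -IH// (mW i); congr (mu _ + mu _); apply/seteqP.
    split=> [x [[Xx _] Wx]|x [Xx Wx]]; split=> //; split=> //.
    by exists i => //; rewrite inE eqxx.
  split=> [x [[Xx [j]]]|x [Xx [j js Wx]]].
    by rewrite inE => /orP[/eqP->//|js Wx _]; split=> //; exists j.
  split=> [|/(disjW _ _ _ Wx) ji]; last by rewrite -ji js in nis.
  by split=> //; exists j => //; rewrite inE js orbT.
rewrite -(sumW (index_enum I) (index_enum_uniq I)); congr (mu _).
rewrite predeqE => x; split=> [Xx|[]//]; split=> //.
by have [i Wx] := coverW x; exists i => //; rewrite mem_index_enum.
Qed.

(* A factor larger than 1 is unavoidable: the part [P] of [W], of relative
   measure [s], may lie anywhere in [W], in particular away from [B]. *)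
Lemma cell_symdiff_le (W P B : set T) (s : R) :
  mu.-caratheodory W -> mu.-caratheodory P -> mu.-caratheodory B ->
  mu W < +oo -> mu (P `\` W) = 0 -> mu P = s%:E * mu W -> (0 <= s <= 1)%R ->
  mu (symdiff B P `&` W) <=
  3%:E * (s%:E * mu (W `\` B) + (1 - s)%:E * mu (W `&` B)).
Proof.
move=> mW mP mB Wfin PW0 Ps /andP[s0 s1].
have real X : X `<=` W -> exists2 r : R, (0 <= r)%R & mu X = r%:E.
  move=> XW; have Xfin : mu X \is a fin_num.
    rewrite ge0_fin_numE ?outer_measure_ge0//.
    by apply: le_lt_trans Wfin; exact: le_outer_measure.
  by exists (fine (mu X)); rewrite ?fineK// fine_ge0// outer_measure_ge0.
(* [B] and [P] divide [W] into four pieces, of measures [x], [y], [z], [t]; the claim becomes a real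
   inequality for [x + t]. *)
have [x x0 xE] := real ((W `\` B) `&` P) (fun _ h => h.1.1).
have [y y0 yE] := real ((W `&` B) `&` P) (fun _ h => h.1.1).
have [z z0 zE] := real ((W `\` B) `\` P) (fun _ h => h.1.1).
have [t t0 tE] := real ((W `&` B) `\` P) (fun _ h => h.1.1).
have WBE : mu (W `\` B) = (x + z)%:E by rewrite (mP (W `\` B)) xE [X in _ + X]zE.
have WIE : mu (W `&` B) = (y + t)%:E by rewrite (mP (W `&` B)) yE [X in _ + X]tE.
have WE : mu W = (y + t + (x + z))%:E by rewrite (mB W) WIE [X in _ + X]WBE.
have PE : mu P = (y + x)%:E.
  rewrite (mW P) [X in _ + X]PW0 adde0 (mB (P `&` W)) (setIC P W) !(setIAC _ P).
  by rewrite yE [X in _ + X]xE.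
have /le_trans : mu (symdiff B P `&` W) <=
    mu ((W `\` B) `&` P) + mu ((W `&` B) `\` P).
  apply: le_trans (outer_measureU2 _ _ _); apply: le_outer_measure.
  by move=> v [[[Bv Pv]|[Pv Bv]] Wv]; [right|left].
apply; rewrite xE tE WBE WIE -!EFinM -!EFinD lee_fin.
move: Ps; rewrite PE WE -EFinM => -[]; rewrite mulrDr mulrBl mul1r => e.
(* The threshold 1/2 gives the constant 3. For small [s], use [x <= y + x = s * mu W] and
   [t <= y + t], with [1 + s <= 3 * (1 - s)]. For large [s], use [t <= t + z = (1 - s) * mu W] and
   [x <= x + z], with [2 - s <= 3 * s]. *)
have [s12|s12] := lerP s (1 / 2).
  have := ler_wpM2r (addr_ge0 y0 t0) s12.
  have := mulr_ge0 s0 (addr_ge0 x0 z0).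
  lra.
have := ler_wpM2r (addr_ge0 x0 z0) (ltW s12).
have := ler_wpM2r (addr_ge0 y0 t0) s1.
lra.
Qed.

(** Venn cells. Unlike [Omega], the cell of the empty index set is the complement of all [A i], so
    that the cells partition the whole space. *)
Definition cell (I : finType) (A : I -> set T) (chi : {set I}) : set T :=
  [set x | forall i, (i \in chi) = `[< A i x >]].

Lemma caratheodory_cell (I : finType) (A : I -> set T) (chi : {set I}) :
  (forall i, mu.-caratheodory (A i)) -> mu.-caratheodory (cell A chi).
Proof.
move=> mA; have cara (s : seq I) : mu.-caratheodory
    [set x | forall i, i \in s -> (i \in chi) = `[< A i x >]].
  elim: s => [|i s IH].
    rewrite [X in _.-caratheodory X](_ : _ = ~` set0).
      exact/caratheodory_measurable_setC/caratheodory_measurable_set0.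
    by apply/seteqP; split=> [x _ []|x _ i].
  rewrite [X in _.-caratheodory X](_ : _ = (if i \in chi then A i else ~` A i)
    `&` [set x | forall i, i \in s -> (i \in chi) = `[< A i x >]]).
    apply: caratheodory_measurable_setI => //.
    by case: ifP => _ //; exact: caratheodory_measurable_setC.
  apply/seteqP; split=> [x Wx|x [Ax Wx] j].
    split=> [|j js]; last by apply: Wx; rewrite inE js orbT.
    have := Wx i (mem_head _ _); case: ifP => _ /esym; first by move/asboolP.
    by move/asboolP.
  rewrite inE => /orP[/eqP->|]; last exact: Wx.
  by case: ifP Ax => _ Ax; apply/esym; [exact/asboolP|exact/asboolP].
rewrite (_ : cell A chi =
  [set x | forall i, i \in enum I -> (i \in chi) = `[< A i x >]])//.
apply/seteqP; split=> [x Wx i _|x Wx i]; first exact: Wx.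
by apply: Wx; rewrite mem_enum.
Qed.

Lemma sum_cell (I : finType) (A : I -> set T) (X : set T) :
  (forall i, mu.-caratheodory (A i)) ->
  mu X = \sum_chi mu (X `&` cell A chi).
Proof.
move=> mA; apply: caratheodory_sum_fin => [chi|x|chi psi x chix psix].
- exact: caratheodory_cell.
- by exists [set i | `[< A i x >]]%SET => i; rewrite inE.
- by apply/setP => i; rewrite chix psix.
Qed.

(** Inside the cell, [symdiff B (A i)] is the part outside [B] if [i \in chi] and the part inside
    [B] otherwise. The sum thus has the form of the right-hand side of [cell_symdiff_le]. *)
Lemma sum_cell_symdiff (I : finType) (alpha : I -> R) (A : I -> set T)
    (B : set T) (chi : {set I}) :
  (forall i, (0 <= alpha i)%R) -> (\sum_i alpha i = 1)%R ->
  \sum_i (alpha i)%:E * mu (symdiff B (A i) `&` cell A chi) =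
  (\sum_(i in chi) alpha i)%:E * mu (cell A chi `\` B) +
  (1 - \sum_(i in chi) alpha i)%:E * mu (cell A chi `&` B).
Proof.
move=> alpha0 alpha1.
have -> : (1 - \sum_(i in chi) alpha i = \sum_(i | i \notin chi) alpha i)%R.
  by rewrite -alpha1 (bigID (mem chi))/= addrAC subrr add0r.
rewrite (bigID (mem chi))/= -!sumEFin.
rewrite !ge0_sume_distrl; try by move=> *; rewrite lee_fin.
congr (_ + _); apply: eq_bigr => i ichi; congr (_ * mu _).
  apply/seteqP; split=> [x [xBA Wx]|x [Wx Bx]].
    have /asboolP Ax : `[< A i x >] by rewrite -(Wx i).
    by case: xBA => -[ABx nABx]; [case: nABx|split].
  by split=> //; right; split=> //; apply/asboolP; rewrite -(Wx i).
apply/seteqP; split=> [x [xBA Wx]|x [Wx Bx]].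
  have /asboolPn Ax : ~~ `[< A i x >] by rewrite -(Wx i).
  by case: xBA => -[ABx nABx]; [split|case: Ax].
by split=> //; left; split=> //; apply/asboolPn; rewrite -(Wx i).
Qed.

(** Both sides are split over the cells, and [cell_symdiff_le] compares them on each nonempty
    index. *)
Lemma average_symdiff_le (I : finType) (alpha : I -> R) (A : I -> set T)
    (B : set T) (P : {set I} -> set T) :
  (forall i, (0 <= alpha i)%R) -> (\sum_i alpha i = 1)%R ->
  (forall i, mu.-caratheodory (A i)) -> mu.-caratheodory B ->
  (forall chi, mu.-caratheodory (P chi)) -> mu (P finset.set0) = 0 ->
  (forall chi, chi != finset.set0 -> mu (cell A chi) < +oo) ->
  (forall chi, chi != finset.set0 -> mu (P chi `\` cell A chi) = 0) ->
  (forall chi, chi != finset.set0 ->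
    mu (P chi) = (\sum_(i in chi) alpha i)%:E * mu (cell A chi)) ->
  mu (symdiff B (\bigcup_chi P chi)) <=
  3%:E * \sum_i (alpha i)%:E * mu (symdiff B (A i)).
Proof.
move=> alpha0 alpha1 mA mB mP P0 cellfin Psub Pmeas.
have -> : \sum_i (alpha i)%:E * mu (symdiff B (A i)) =
    \sum_chi \sum_i (alpha i)%:E * mu (symdiff B (A i) `&` cell A chi).
  rewrite exchange_big/=; apply: eq_bigr => i _.
  rewrite (sum_cell _ mA) ge0_sume_distrr// => chi _.
  exact: outer_measure_ge0.
rewrite (sum_cell _ mA) ge0_sume_distrr => [|chi _]; last first.
  apply: sume_ge0 => i _.
  by rewrite mule_ge0 ?lee_fin ?outer_measure_ge0.
apply: lee_sum => chi _; rewrite sum_cell_symdiff//.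
have alphachi : (0 <= \sum_(i in chi) alpha i <= 1)%R.
  rewrite sumr_ge0//= -alpha1 [leRHS](bigID (mem chi))/= lerDl.
  exact: sumr_ge0.
(* All that the sets [P psi] place outside their own cells is null, so on the cell of [chi] the
   union may be replaced by [P chi]. *)
have null : mu (\bigcup_psi (P psi `\` cell A psi)) = 0.
  apply: outer_measure_null_fin => psi.
  have [->|/Psub//] := eqVneq psi finset.set0.
  apply/eqP; rewrite eq_le outer_measure_ge0 andbT -P0.
  by apply: le_outer_measure; exact: subDsetl.
apply: (@le_trans _ _ (mu (symdiff B (P chi) `&` cell A chi))).
  rewrite -[leRHS]adde0 -[X in _ + X]null.
  apply: le_trans (outer_measureU2 _ _ _); apply: le_outer_measure.
  move=> x [[[Bx Ux]|[[psi _ Px] Bx]] Wx].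
    by left; split=> //; left; split=> // Px; apply: Ux; exists chi.
  have [Wpsi|] := pselect (cell A psi x); last by right; exists psi.
  have psichi : psi = chi by apply/setP => i; rewrite Wx Wpsi.
  by left; split=> //; right; rewrite -psichi.
(* The empty index is separate, since its cell may have infinite measure: there [P] is null and only
   the part of [B] in the cell counts, with weight 1. *)
have [chi0|chi0] := eqVneq chi finset.set0; last first.
  apply: cell_symdiff_le => //; [|exact: cellfin|exact: Psub|exact: Pmeas].
  exact: caratheodory_cell.
rewrite {}chi0 big_set0 mul0e add0e subr0 mul1e.
apply: (@le_trans _ _ (mu (cell A finset.set0 `&` B))); last first.
  rewrite -[leLHS]mul1e; apply: lee_wpmul2r; first exact: outer_measure_ge0.
  by rewrite lee_fin ler1n.
rewrite -[leRHS]adde0 -[X in _ + X]P0.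
apply: le_trans (outer_measureU2 _ _ _); apply: le_outer_measure.
by move=> x [[[Bx Px]|[Px Bx]] Wx]; [left|right].
Qed.

End average.

(** * Boundaries of Venn cells *)

Lemma near_boundaryC (T : topologicalType) (A : set T) (x : T) :
  ~ (closure A `\` A°) x -> \forall y \near x, A y <-> A x.
Proof.
move=> ndAx; have [Ax|nAx] := pselect (A° x).
  by apply: filterS (Ax) => y Ay; split=> // _; exact: interior_subset Ax.
have nclA : ~ closure A x by move=> clA; exact: ndAx.
have : nbhs x (~` closure A).
  by apply: open_nbhs_nbhs; split=> //; exact/closed_openC/closed_closure.
apply: filterS => y nAy.
by split=> ?; [case: nAy|case: nclA]; exact: subset_closure.
Qed.

(** Off all the boundaries, membership in every [A i] is locally constant, hence so is membership in
    the cell; a closure point is then interior. *)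
Lemma boundary_cell (T : topologicalType) (I : finType) (A : I -> set T)
    (chi : {set I}) :
  closure (cell A chi) `\` (cell A chi)° `<=`
  \bigcup_i (closure (A i) `\` (A i)°).
Proof.
move=> x [clW nW]; apply: contrapT => ndA.
have near_const : \forall y \near x, forall i, A i y <-> A i x.
  by apply: filter_forall => i; apply: near_boundaryC => dA; apply: ndA; exists i.
have [y [Wy Ay]] := clW _ near_const.
apply: nW; apply: filterS near_const => z Az i.
by rewrite (Wy i); apply: asbool_equiv_eq; rewrite (Ay i) (Az i).
Qed.

Lemma OmegaE (R : realType) (m n : nat) (A : 'I_n.+1 -> set 'rV[R]_m)
    (chi : {set 'I_n.+1}) :
  chi != finset.set0 -> Omega A chi = cell A chi.
Proof.
move=> /negbTE chi0; rewrite /Omega chi0; apply/seteqP; split.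
  move=> x [Ax nAx] i; apply/esym/asboolP; case: ifPn => ichi; first exact: Ax.
  by move=> Aix; apply: nAx; exists i.
move=> x Wx; split=> [i /= ichi|[i /= /negP ichi Ax]].
  by apply/asboolP; rewrite -Wx.
by apply: ichi; rewrite Wx; exact/asboolP.
Qed.

(** * Jordan sets, the distance [dmu] and the averaging inequality *)

Section jordan.
Context (R : realType) (m : nat).
Local Notation mu := (@lebesgue_Rm R m.+1).
Implicit Types A B C : set 'rV[R]_m.+1.
Local Open Scope ereal_scope.

Lemma jordan_measurable0 : jordan_measurable (set0 : set 'rV[R]_m.+1).
Proof.
split; first by apply: nearW => M x.
by rewrite closure0 set0D lebesgue_Rm0.
Qed.

(** A nonempty [chi] places the cell inside some [A i], which bounds it; its boundary lies in
    finitely many null sets. *)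
Lemma jordan_cell (I : finType) (A : I -> set 'rV[R]_m.+1) (chi : {set I}) :
  (forall i, jordan_measurable (A i)) -> chi != finset.set0 ->
  jordan_measurable (cell A chi).
Proof.
move=> jA /finset.set0Pn[i ichi]; split.
  have := (jA i).1; rewrite /mkset /bounded_near; apply: filterS => M AM x Wx; apply: AM.
  by apply/asboolP; rewrite -Wx.
apply/eqP; rewrite eq_le outer_measure_ge0 andbT.
rewrite -(outer_measure_null_fin (fun j => (jA j).2)).
by apply: le_outer_measure; exact: boundary_cell.
Qed.

Lemma dmuE A B : dmu A B = mu (symdiff A B).
Proof. by []. Qed.

Lemma dmu_ge0 A B : 0 <= dmu A B.
Proof. exact: lebesgue_Rm_ge0. Qed.

Lemma dmuC A B : dmu A B = dmu B A.
Proof. by rewrite !dmuE /symdiff setUC. Qed.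

Lemma dmu_triangle A B C : dmu A C <= dmu A B + dmu B C.
Proof.
apply: le_trans (outer_measureU2 _ _ _); apply: le_outer_measure => x.
have [Bx|nBx] := pselect (B x) => -[[Ax Cx]|[Cx Ax]].
- by right; left.
- by left; right.
- by left; left.
- by right; right.
Qed.

Lemma dmu_fin_num A B :
  jordan_measurable A -> jordan_measurable B -> dmu A B \is a fin_num.
Proof.
move=> [bA _] [bB _]; rewrite ge0_fin_numE ?dmu_ge0//.
apply: le_lt_trans (lte_add_pinfty (bounded_lebesgue_Rm bA)
  (bounded_lebesgue_Rm bB)).
apply: le_trans (outer_measureU2 _ _ _); apply: le_outer_measure.
by move=> x [[Ax _]|[Bx _]]; [left|right].
Qed.

Lemma partition_average_dmu_le (Psi : set 'rV[R]_m.+1 -> R -> set 'rV[R]_m.+1)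
    (n : nat) (alpha : 'I_n.+1 -> R) (A : 'I_n.+1 -> set 'rV[R]_m.+1) B :
  subset_generating Psi -> (forall i, (0 <= alpha i)%R) ->
  (\sum_i alpha i = 1)%R -> (forall i, jordan_measurable (A i)) ->
  jordan_measurable B ->
  dmu B (partition_average Psi alpha A) <=
  3%:E * \sum_i (alpha i)%:E * dmu B (A i).
Proof.
move=> [Psi_reg Psi_sub Psi_meas _] alpha0 alpha1 jA jB.
have weight (chi : {set 'I_n.+1}) : (0 <= \sum_(i in chi) alpha i <= 1)%R.
  rewrite sumr_ge0//= -alpha1 [leRHS](bigID (mem chi))/= lerDl.
  exact: sumr_ge0.
have Omega0 : Omega A finset.set0 = set0 by rewrite /Omega eqxx.
have jOmega chi : jordan_measurable (Omega A chi).
  have [->|chi0] := eqVneq chi finset.set0.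
    by rewrite Omega0; exact: jordan_measurable0.
  by rewrite OmegaE//; exact: jordan_cell.
apply: average_symdiff_le => //.
- by move=> i; exact: jordan_caratheodory.
- exact: jordan_caratheodory.
- by move=> chi; apply/jordan_caratheodory/(Psi_reg _ _ _ _).1.
(* The empty index contributes [Psi] of the empty set, which is null by the measure axiom. *)
- have /= -> := Psi_meas _ _ (jOmega finset.set0) (weight finset.set0).
  by rewrite Omega0 lebesgue_Rm0 mule0.
- by move=> chi chi0; exact: bounded_lebesgue_Rm (jordan_cell jA chi0).1.
- by move=> chi chi0; rewrite -OmegaE//; exact: Psi_sub.
- by move=> chi chi0; rewrite -OmegaE//; exact: Psi_meas.
Qed.

End jordan.

(** * Continuity of the distance to a fixed value of [F] *)

Section continuity.
Context (R : realType) (d m : nat) (K : set 'rV[R]_d).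
Variable F : 'rV[R]_d -> set 'rV[R]_m.+1.
Hypothesis jF : forall p, K p -> jordan_measurable (F p).

(** By the triangle inequality the values at [p] and [q] differ by at most [dmu (F p) (F q)]; [fine]
    loses nothing, as distances of Jordan sets are finite. *)
Lemma dmu_continuous_fine (p0 : 'rV[R]_d) :
  dmu_continuous K F -> K p0 ->
  {within K, continuous (fun q => fine (dmu (F p0) (F q)))}.
Proof.
move=> cF Kp0; apply/subspace_continuousP => p Kp.
apply/cvgrPdist_lt => e e0; have := cF p Kp e e0.
rewrite !near_withinE; apply: filterS => q + Kq => /(_ Kq) pq.
have := dmu_triangle (F p0) (F p) (F q).
have := dmu_triangle (F p0) (F q) (F p).
rewrite (dmuC (F q)); move: pq.
have := dmu_fin_num (jF Kp0) (jF Kp).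
have := dmu_fin_num (jF Kp0) (jF Kq).
have := dmu_fin_num (jF Kp) (jF Kq).
do 3! move=> /fineK <-; rewrite /= -!EFinD !lee_fin lte_fin => ? ? ?.
by rewrite ltr_norml /from_subspace; lra.
Qed.

End continuity.

(** * Uniform approximation on the compact set *)

Theorem mainTheorem7 (R : realType) (m : nat) (m_ge1 : (1 <= m)%N)
    (Psi : set 'rV[R]_m -> R -> set 'rV[R]_m) (hPsi : subset_generating Psi)
    (d : nat) (K : set 'rV[R]_d) (cptK : compact K)
    (l : nat -> nat)
    (pt : forall n : nat, 'I_(l n).+1 -> 'rV[R]_d)
    (c : forall n : nat, 'I_(l n).+1 -> 'rV[R]_d -> R)
    (ptK : forall (n : nat) (i : 'I_(l n).+1), K (pt n i))
    (c_ge0 : forall (n : nat) (i : 'I_(l n).+1) (p : 'rV[R]_d),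
      K p -> 0 <= c n i p)
    (c_sum1 : forall (n : nat) (p : 'rV[R]_d),
      K p -> \sum_(i < (l n).+1) c n i p = 1)
    (delta_cvg0 : forall p : 'rV[R]_d,
      K p -> delta pt n p @[n --> \oo] --> (0 : R))
    (real_approx : forall f : 'rV[R]_d -> R, {within K, continuous f} ->
      forall eps : R, 0 < eps -> exists N : nat, forall n : nat, (N <= n)%N ->
      forall p : 'rV[R]_d, K p -> `|f p - real_operator pt c n f p| < eps) :
  forall F : 'rV[R]_d -> set 'rV[R]_m,
    (forall p : 'rV[R]_d, K p -> regular_jordan (F p)) ->
    dmu_continuous K F ->
    forall eps : R, 0 < eps -> exists N : nat, forall n : nat, (N <= n)%N ->
    forall p : 'rV[R]_d, K p ->
      (dmu (F p) (set_operator pt c Psi n F p) < eps%:E)%E.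
Proof.
case: m m_ge1 Psi hPsi => // m _ Psi hPsi F rF cF eps eps0.
have jF p : K p -> jordan_measurable (F p) by move=> /rF[].
pose P n p := (dmu (F p) (set_operator pt c Psi n F p) < eps%:E)%E.
suff [N _ NP] : \forall n \near \oo, K `<=` P n by exists N => n /NP nP p /nP.
(* Compactness reduces the claim to [p] near a fixed [p0] and [n] large. *)
move/compact_near_coveringP/near_covering_withinP : cptK; apply=> p0 Kp0.
pose f q := fine (dmu (F p0) (F q)).
have fE q : K q -> (f q)%:E = dmu (F p0) (F q).
  by move=> Kq; rewrite fineK// dmu_fin_num//; exact: jF.
(* With [f p < eps / 9] and an approximation error below [eps / 9], the operator value is below
   [2 * eps / 9], so three times the sum stays below [eps]. *)
have e0 : 0 < eps / 9 by rewrite divr_gt0.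
have [N fN] := real_approx f (dmu_continuous_fine jF cF Kp0) _ e0.
near=> p n => /= Kp; rewrite /P.
have fp : f p < eps / 9.
  rewrite -lte_fin fE//; move: (Kp); near: p.
  by have := cF p0 Kp0 _ e0; rewrite near_withinE.
have /(fN n)/(_ p Kp) fn : (N <= n)%N by near: n; exists N.
apply: (le_lt_trans (partition_average_dmu_le hPsi
  (fun i => c_ge0 n i p Kp) (c_sum1 n p Kp) (fun i => jF _ (ptK n i)) (jF _ Kp))).
(* Each distance from [F p] to [F (pt n i)] is bounded by passing through [F p0]. *)
apply: (@le_lt_trans _ _ (3 * \sum_i c n i p * (f p + f (pt n i)))%:E).
  rewrite EFinM -sumEFin; apply: lee_wpmul2l; first by rewrite lee_fin.
  apply: lee_sum => i _; rewrite EFinM; apply: lee_wpmul2l.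
    by rewrite lee_fin; exact: c_ge0.
  have Kpt := ptK n i; rewrite EFinD !fE//.
  by rewrite (dmuC (F p0) (F p)); exact: dmu_triangle.
under eq_bigr do rewrite mulrDr.
rewrite big_split/= -mulr_suml (c_sum1 n p Kp) mul1r lte_fin.
move: fn; rewrite /real_operator ltr_norml => /andP[+ _].
by move: fp; lra.
Unshelve. all: by end_near. Qed.
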